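(* For $i=1,2$, let $\alpha_i,\beta_i,\gamma_i$ be positive real numbers such that $\alpha_i,\beta_i>\gamma_i$. The analytic Hilbert modules $\mathcal{H}^{(\alpha_1,\beta_1,\gamma_1)}$ and $\mathcal{H}^{(\alpha_2,\beta_2,\gamma_2)}$ are unitarily equivalent if and only if $\alpha_1=\alpha_2$, $\beta_1=\beta_2$ and $\gamma_1=\gamma_2$.
   Context: $\mathbb{D}$ is the open unit disc in $\mathbb{C}$. For $\alpha,\beta>\gamma>0$, $\mathcal{H}^{(\alpha,\beta,\gamma)}$ is the reproducing kernel Hilbert space of holomorphic functions on $\mathbb{D}^2$ with (non-negative definite) reproducing kernel $$B_{(\alpha,\beta,\gamma)}(\boldsymbol z,\boldsymbol w)=(1-z_1\overline{w}_1)^{-\alpha}(1-z_2\overline{w}_2)^{-\beta}(1-z_1\overline{w}_2)^{\gamma}(1-z_2\overline{w}_1)^{\gamma}$$ (principal branches). It is an analytic Hilbert module: polynomials are contained and dense in it, and the operators $M_{z_1},M_{z_2}$ of multiplication by the coordinate functions are bounded. Two analytic Hilbert modules $\mathcal{H},\mathcal{H}'$ on $\mathbb{D}^2$ are unitarily equivalent if there is a unitary $U:\mathcal{H}\to\mathcal{H}'$ with $UM_{z_i}=M_{z_i}U$ for $i=1,2$. *)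

(* Defs.v *)
From HB Require Import structures.
From mathcomp Require Import all_boot all_order all_algebra complex.
From mathcomp Require Import all_classical all_reals all_analysis.

Set Implicit Arguments.
Unset Strict Implicit.
Unset Printing Implicit Defensive.

Import Order.TTheory GRing.Theory Num.Theory.
Import numFieldNormedType.Exports.

Local Open Scope ring_scope.

(* The values are in ]-pi, pi]; the value at 0 is irrelevant. *)
Definition principal_arg (R : realType) (z : R[i]) : R :=
  let t := acos (complex.Re z / ComplexField.Normc.normc z) in
  if 0 <= complex.Im z then t else - t.

(* Principal branch of z ^ a for z != 0, i.e. exp (a * (ln |z| + i arg z)). *)
Definition principal_pow (R : realType) (z : R[i]) (a : R) : R[i] :=
  (ComplexField.Normc.normc z `^ a)%:C%C *
  Complex (cos (a * principal_arg z)) (sin (a * principal_arg z)).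

Definition bidisc (R : realType) (z : R[i] * R[i]) : Prop :=
  `|z.1| < 1 /\ `|z.2| < 1.

Definition coord (R : realType) (i : 'I_2) (z : R[i] * R[i]) : R[i] :=
  if i == ord0 then z.1 else z.2.

Definition kernelB (R : realType) (alpha beta gamma : R)
    (z w : R[i] * R[i]) : R[i] :=
  principal_pow (1 - z.1 * (w.1)^*%C) (- alpha) *
  principal_pow (1 - z.2 * (w.2)^*%C) (- beta) *
  principal_pow (1 - z.1 * (w.2)^*%C) gamma *
  principal_pow (1 - z.2 * (w.1)^*%C) gamma.

(* Frechet differentiability over R[i]; the alias ^o selects the structure of
   normed space of R[i] over itself. *)
Definition holomorphic_on_bidisc (R : realType)
    (h : R[i] * R[i] -> R[i]) : Prop :=
  forall z : (R[i]^o * R[i]^o)%type, bidisc z ->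
    differentiable (h : (R[i]^o * R[i]^o)%type -> R[i]^o) z.

(* A Hilbert space of functions on the bidisc is given by an abstract complex
   Hilbert space with an evaluation map; the values of [ahm_eval f] outside the
   bidisc are meaningless.  Inner products are linear on the left. *)
Record analyticHilbertModule (R : realType) := AnalyticHilbertModule {
  ahm_space :> completeNormedModType R[i] ;
  ahm_dot : {dot ahm_space for Num.conj} ;
  ahm_norm : forall f, `|f| = sqrtC (ahm_dot f f) ;
  ahm_eval : ahm_space -> R[i] * R[i] -> R[i] ;
  ahm_eval_linear : forall (a : R[i]) f g z, bidisc z ->
    ahm_eval (a *: f + g) z = a * ahm_eval f z + ahm_eval g z ;
  ahm_eval_inj : forall f g,
    (forall z, bidisc z -> ahm_eval f z = ahm_eval g z) -> f = g ;
  ahm_holomorphic : forall f, holomorphic_on_bidisc (ahm_eval f) ;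
  ahm_poly : forall p : {poly {poly R[i]}}, exists f,
    forall z, bidisc z -> ahm_eval f z = p.[z.1, z.2] ;
  ahm_poly_dense :
    dense [set f | exists p : {poly {poly R[i]}},
                     forall z, bidisc z -> ahm_eval f z = p.[z.1, z.2]] ;
  (* multiplication by the i-th coordinate function *)
  ahm_mul : 'I_2 -> ahm_space -> ahm_space ;
  ahm_mulE : forall i f z, bidisc z ->
    ahm_eval (ahm_mul i f) z = coord i z * ahm_eval f z ;
  ahm_mul_bounded : forall i, exists c : R[i],
    forall f, `|ahm_mul i f| <= c * `|f| }.

Definition has_reproducing_kernel (R : realType) (H : analyticHilbertModule R)
    (K : R[i] * R[i] -> R[i] * R[i] -> R[i]) : Prop :=
  forall w, bidisc w -> exists k : H,
    (forall z, bidisc z -> ahm_eval k z = K z w) /\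
    (forall f : H, ahm_eval f w = ahm_dot H f k).

Definition unitarily_equivalent (R : realType)
    (H H' : analyticHilbertModule R) : Prop :=
  exists U : {linear H -> H'},
    [/\ isometry (ahm_dot H') (ahm_dot H) U, 
        set_bij setT setT U
      & forall i f, U (ahm_mul i f) = ahm_mul i (U f)].

(* Main.v *)
(* If U intertwines the coordinate multiplications then U p = p * phi for every
   polynomial p, where phi = U 1, and by density of the polynomials
   K2(z,w) = phi(z) (phi w)^* K1(z,w).  Both kernels are 1 at (z,0), so
   phi (phi 0)^* = 1, hence K1 = K2, and the exponents are read off at a few
   real points.  Conversely, a Hilbert space of functions is determined by its
   kernel: kernel sections are total, because a minimizing sequence for the
   distance to their span converges pointwise to the given function. *)
From HB Require Import structures.
Require Import Defs.
From mathcomp Require Import all_boot all_order all_algebra complex.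
From mathcomp Require Import all_classical all_reals all_analysis.
From mathcomp Require Import ring.

Set Implicit Arguments.
Unset Strict Implicit.
Unset Printing Implicit Defensive.

Import Order.TTheory GRing.Theory Num.Theory.
Import numFieldNormedType.Exports.

Local Open Scope ring_scope.
Local Open Scope classical_set_scope.

(** * Inner product spaces *)

Section DotTheory.
Context {C : numClosedFieldType} {E : lmodType C} (dot : {dot E for Num.conj}).

Lemma dotC (u v : E) : dot u v = (dot v u)^*.
Proof. by rewrite hermC mul1r. Qed.

Lemma parallelogram (u v : E) :
  dot (u + v) (u + v) + dot (u - v) (u - v) = dot u u *+ 2 + dot v v *+ 2.
Proof. by rewrite dnormD dnormB; ring. Qed.

(* With [d] the squared distance of [e] to a subspace containing [v], an almost
   minimal [e] is almost orthogonal to [v]. *)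
Lemma sqr_normr_dot_le (d : C) (e v : E) :
  (forall c, d <= dot (e - c *: v) (e - c *: v)) ->
  `|dot e v| ^+ 2 <= dot v v * (dot e e - d).
Proof.
move=> dmin; have [->|v0] := eqVneq v 0.
  by rewrite !linear0r normr0 expr0n mul0r.
have vv0 : 0 < dot v v by rewrite dnorm_gt0.
rewrite -ler_pdivrMl//; set x := dot e v; set q := dot v v in vv0 *.
have qVr : q^-1^* = q^-1 by apply/conj_Creal/ger0_real/ltW; rewrite invr_gt0.
have xq : (x / q)^* * x = q^-1 * `|x| ^+ 2.
  by rewrite rmorphM/= qVr normCK; ring.
have xqr : (q^-1 * `|x| ^+ 2)^* = q^-1 * `|x| ^+ 2.
  by rewrite rmorphM/= qVr conj_Creal// rpredX.
(* [x / q] is the coefficient of the orthogonal projection of [e] onto [v], so this choice gives the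
   sharpest bound. *)
have := dmin (x / q); rewrite dnormB dnormZ linearZr_LR/= -/x -/q xq xqr.
rewrite normrM normfV (gtr0_norm vv0) => /le_trans h.
rewrite lerBrDl -lerBrDr; apply: h.
by rewrite le_eqVlt; apply/orP; left; apply/eqP; field; exact: lt0r_neq0.
Qed.

Lemma dot_CauchySchwarz (u v : E) : `|dot u v| ^+ 2 <= dot u u * dot v v.
Proof.
have := @sqr_normr_dot_le 0 u v (fun c => dnorm_ge0 dot _).
by rewrite subr0 mulrC.
Qed.

End DotTheory.

(** Polarization: the defect [D] is sesquilinear, and equality of norms makes it antisymmetric.
    Replacing [x] by ['i *: x] makes it symmetric as well, so it vanishes. *)
Lemma isometry_dnorm {C : numClosedFieldType} {E F : lmodType C}
    (dotE : {dot E for Num.conj}) (dotF : {dot F for Num.conj})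
    (U : {linear E -> F}) :
  (forall x, dotF (U x) (U x) = dotE x x) -> isometry dotF dotE U.
Proof.
move=> Unorm x y.
pose D u v := dotF (U u) (U v) - dotE u v.
have DD u v : D u v + D v u = 0.
  have := Unorm (u + v); rewrite linearD !dnormD !Unorm /D.
  rewrite -!(dotC _ v) -!(dotC _ (U v)).
  by move=> /addrI h; rewrite addrACA h -opprD subrr.
have DZl c u v : D (c *: u) v = c * D u v.
  by rewrite /D linearZ !linearZl_LR/= mulrBr.
have DZr c u v : D u (c *: v) = c^* * D u v.
  by rewrite /D linearZ !linearZr_LR/= mulrBr.
have := DD ('i *: x) y; rewrite DZl DZr conjCi mulNr -mulrBr => /eqP.
rewrite mulf_eq0 (negPf (neq0Ci _))/= subr_eq0 => /eqP Dxy.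
have := DD x y; rewrite -Dxy -mulr2n => /eqP; rewrite mulrn_eq0/= => /eqP.
by move=> /subr0_eq.
Qed.

(** A positive element of [R[i]] is real, so the archimedean property of [R] applies. *)
Lemma near_natSinv_lt_complex (R : realType) (e : R[i]) : 0 < e ->
  \forall n \near \oo, (n.+1%:R^-1 : R[i]) < e.
Proof.
move=> e0; have er : (complex.Re e)%:C%C = e by apply/RRe_real/gtr0_real.
have re0 : 0 < complex.Re e by rewrite -ltcR er.
near=> n; rewrite -er.
have -> : (n.+1%:R^-1 : R[i]) = (n.+1%:R^-1 : R)%:C%C.
  by rewrite fmorphV/= rmorph_nat.
by rewrite ltcR; near: n; exact: (near_infty_natSinv_lt (PosNum re0)).
Unshelve. all: by end_near. Qed.

(** * Convergence and evaluation in an analytic Hilbert module *)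

Section ModuleTheory.
Context {R : realType} (H : analyticHilbertModule R).
Implicit Types (f g : H) (u : nat -> H).
Local Notation dot := (ahm_dot H).
Local Notation ev := (@ahm_eval R H).

Lemma dot_sqr_norm f : dot f f = `|f| ^+ 2.
Proof. by rewrite ahm_norm sqrtCK. Qed.

Lemma ahm_evalD z f g : bidisc z -> ev (f + g) z = ev f z + ev g z.
Proof. by move=> zD; rewrite -[f]scale1r ahm_eval_linear// mul1r scale1r. Qed.

Lemma ahm_eval0 z : bidisc z -> ev 0 z = 0.
Proof.
by move=> zD; apply: (@addrI _ (ev 0 z)); rewrite -ahm_evalD// !addr0.
Qed.

Lemma ahm_evalZ a z f : bidisc z -> ev (a *: f) z = a * ev f z.
Proof.
by move=> zD; rewrite -[a *: f]addr0 ahm_eval_linear// ahm_eval0// addr0.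
Qed.

Lemma ahm_evalB z f g : bidisc z -> ev (f - g) z = ev f z - ev g z.
Proof. by move=> zD; rewrite ahm_evalD// -scaleN1r ahm_evalZ// mulN1r. Qed.

(** The bound is the one that the parallelogram law yields for a minimizing sequence; it makes [u]
    Cauchy. *)
Lemma cvg_of_dot_le u :
  (forall n m, dot (u n - u m) (u n - u m) <= (n.+1%:R^-1 + m.+1%:R^-1) *+ 2) ->
  cvgn u.
Proof.
move=> u_le; apply/cauchy_cvgP/cauchy_exP => e e0.
have e4 : 0 < e ^+ 2 / 4 by rewrite divr_gt0// exprn_gt0.
have [N _ NP] := near_natSinv_lt_complex e4.
exists (u N); exists N => // n Nn; rewrite -ball_normE/=.
rewrite -(@ltr_pXn2r _ 2)// ?nnegrE ?(ltW e0)// -dot_sqr_norm.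
rewrite (le_lt_trans (u_le _ _))//.
have -> : e ^+ 2 = (e ^+ 2 / 4 + e ^+ 2 / 4) *+ 2 by field.
by rewrite ltrMn2r/=; apply: ltrD; apply: NP => /=.
Qed.

(** By Pythagoras, a vector orthogonal to [g] lies at distance at least [|g|] from [g], so the open
    ball of that radius would miss [A]. *)
Lemma dense_dot_eq0 (A : set H) g : dense A -> (forall f, A f -> dot f g = 0) ->
  g = 0.
Proof.
move=> Ad Ag; apply/eqP/negPn/negP => g0.
have gpos : 0 < `|g| by rewrite normr_gt0.
have [f [gf Af]] : ball g `|g| `&` A !=set0.
  by apply: Ad; [exists g; exact: ballxx | exact: ball_open].
have gf0 : dot g f = 0 by rewrite dotC (Ag f)// conjC0.
move: gf; rewrite -ball_normE/= -(@ltr_pXn2r _ 2)// ?nnegrE//.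
rewrite -!dot_sqr_norm dnormB gf0 conjC0 addr0 subr0.
by rewrite gtrDl le_gtF ?dnorm_ge0.
Qed.

Lemma eval_cvg w (k : H) u g : (forall f, ev f w = dot f k) ->
  u @ \oo --> g -> (fun n => ev (u n) w : R[i]^o) @ \oo --> (ev g w : R[i]^o).
Proof.
move=> kP ug; apply/cvgrPdist_lt => e e0.
(* By Cauchy-Schwarz evaluation at [w] is [|k|]-Lipschitz; adding 1 allows the division when [k] is
   0. *)
have k1 : 0 < `|k| + 1 by rewrite ltr_wpDl.
have /cvgrPdist_lt /(_ (e / (`|k| + 1))) := ug.
rewrite divr_gt0// => /(_ isT); apply: filterS => n.
rewrite ltr_pdivlMr// => h; apply: le_lt_trans h.
rewrite !kP -linearBl -(@ler_pXn2r _ 2)// ?nnegrE ?mulr_ge0 ?addr_ge0//.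
rewrite (le_trans (dot_CauchySchwarz _ _ _))// !dot_sqr_norm -exprMn.
by rewrite ler_pXn2r ?nnegrE ?mulr_ge0 ?addr_ge0// ler_wpM2l// lerDl.
Qed.

End ModuleTheory.

(* Setting the sections to [0] off the bidisc spares side conditions in linear
   combinations. *)
Definition kernel_sections (R : realType) (H : analyticHilbertModule R)
    (K : R[i] * R[i] -> R[i] * R[i] -> R[i]) (k : R[i] * R[i] -> H) :=
  (forall w, bidisc w -> (forall z, bidisc z -> ahm_eval (k w) z = K z w) /\
                         (forall f, ahm_eval f w = ahm_dot H f (k w))) /\
  (forall w, ~ bidisc w -> k w = 0).

Lemma kernel_sectionsP (R : realType) (H : analyticHilbertModule R)
    (K : R[i] * R[i] -> R[i] * R[i] -> R[i]) :
  has_reproducing_kernel H K -> exists k, kernel_sections (H := H) K k.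
Proof.
move=> HK.
have /choice[k kP] : forall w, exists k : H, (bidisc w ->
    (forall z, bidisc z -> ahm_eval k z = K z w) /\
    (forall f, ahm_eval f w = ahm_dot H f k)) /\ (~ bidisc w -> k = 0).
  move=> w; have [wD|wD] := pselect (bidisc w); last by exists 0.
  by have [k kP] := HK _ wD; exists k.
by exists k; split=> w; [exact: (kP w).1|exact: (kP w).2].
Qed.

(** * Approximation by finite combinations of kernel sections *)

Section Combination.
Context {R : realType} (H : analyticHilbertModule R).
Context (K : R[i] * R[i] -> R[i] * R[i] -> R[i]) (k : R[i] * R[i] -> H).
Hypothesis kP : kernel_sections K k.
Local Notation dot := (ahm_dot H).

(** Indexing by lists of coefficients and points lets one list be realized in two modules with the
    same kernel. *)
Definition comb (l : seq (R[i] * (R[i] * R[i]))) : H :=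
  \sum_(p <- l) p.1 *: k p.2.

Lemma comb_cat l l' : comb (l ++ l') = comb l + comb l'.
Proof. by rewrite /comb big_cat. Qed.

Lemma comb_scale a l : comb [seq (a * p.1, p.2) | p <- l] = a *: comb l.
Proof.
by rewrite /comb big_map scaler_sumr; apply: eq_bigr => p _; rewrite scalerA.
Qed.

Lemma eval_comb z l : bidisc z ->
  ahm_eval (comb l) z = \sum_(p <- l | `[< bidisc p.2 >]) p.1 * K z p.2.
Proof.
move=> zD; rewrite /comb; elim: l => [|p l IHl].
  by rewrite !big_nil ahm_eval0.
rewrite !big_cons ahm_evalD// ahm_evalZ// IHl; case: asboolP => pD.
  by rewrite (kP.1 _ pD).1.
by rewrite kP.2// ahm_eval0// mulr0 add0r.
Qed.

(** Together with [eval_comb], this shows that inner products of combinations depend on [K]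
    alone. *)
Lemma dot_comb l l' : dot (comb l) (comb l') =
  \sum_(p <- l' | `[< bidisc p.2 >]) p.1^* * ahm_eval (comb l) p.2.
Proof.
rewrite {2}/comb; elim: l' => [|p l' IHl]; first by rewrite !big_nil linear0r.
rewrite !big_cons linearDr linearZr_LR/= IHl; case: asboolP => pD.
  by rewrite (kP.1 _ pD).2.
by rewrite kP.2// linear0r mulr0 add0r.
Qed.

Lemma minimizing_comb (f : H) : exists (d : R[i]) (l : nat -> seq _),
  (forall l', d <= dot (f - comb l') (f - comb l')) /\
  (forall n, dot (f - comb (l n)) (f - comb (l n)) <= d + n.+1%:R^-1).
Proof.
(* The order of [R[i]] is partial, so the infimum is taken over real parts. *)
pose N l := complex.Re (dot (f - comb l) (f - comb l)).
have NE l : dot (f - comb l) (f - comb l) = (N l)%:C%C.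
  by rewrite RRe_real// ger0_real.
have N0 l : 0 <= N l by rewrite -ler0c -NE dnorm_ge0.
have Nlb : has_lbound (range N) by exists 0 => _ [l _ <-].
have Ninf : has_inf (range N) by split => //; exists (N [::]), [::].
have /choice[l lP] : forall n, exists l, N l <= inf (range N) + n.+1%:R^-1.
  move=> n; have [|_ [l _ <-] h] := @inf_adherent _ _ (n.+1%:R^-1 : R) _ Ninf.
    by rewrite invr_gt0.
  by exists l; exact: ltW.
exists (inf (range N))%:C%C, l; split=> [l'|n].
  by rewrite NE lecR; apply: ge_inf => //; exists l'.
rewrite NE (_ : n.+1%:R^-1 = (n.+1%:R^-1 : R)%:C%C); last first.
  by rewrite fmorphV/= rmorph_nat.
by rewrite -rmorphD/= lecR.
Qed.

(** The distance [d] is not known to be 0. Still, a minimizing sequence is Cauchy by the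
    parallelogram law, and its errors become orthogonal to every section, that is, tend to 0
    pointwise. *)
Lemma approx_comb (f : H) : exists l : nat -> seq _,
  (forall n m, dot (comb (l n) - comb (l m)) (comb (l n) - comb (l m)) <=
               (n.+1%:R^-1 + m.+1%:R^-1) *+ 2) /\
  (forall w, bidisc w ->
    (fun n => ahm_eval (comb (l n)) w : R[i]^o) @ \oo -->
      (ahm_eval f w : R[i]^o)).
Proof.
have [d [l [dmin lP]]] := minimizing_comb f; exists l; split=> [n m|w wD].
  set u := f - comb (l n); set v := f - comb (l m).
  have -> : comb (l n) - comb (l m) = v - u.
    by rewrite /u /v opprB [RHS]addrC addrA subrK.
  have := parallelogram dot v u.
  (* The midpoint of two combinations is a combination, so its squared distance to [f] is at least
     [d]. *)
  pose mid := [seq (2^-1 * p.1, p.2) | p <- l n ++ l m].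
  have -> : v + u = 2 *: (f - comb mid).
    rewrite /mid comb_scale comb_cat scalerBr scalerA divff// scale1r.
    by rewrite scaler_nat mulr2n /u /v opprD addrACA (addrC (- comb (l n))).
  rewrite dnormZ (ger0_norm (ler0n _ _)) => vu.
  have {vu} -> : dot (v - u) (v - u) = dot v v *+ 2 + dot u u *+ 2 -
      2 ^+ 2 * dot (f - comb mid) (f - comb mid).
    by rewrite -vu [RHS]addrC addKr.
  have hu := lP n; have hv := lP m; have hd := dmin mid.
  rewrite -/u in hu; rewrite -/v in hv.
  rewrite -subr_ge0; set X := dot (f - _) _ in hd *.
  have -> : (n.+1%:R^-1 + m.+1%:R^-1) *+ 2 -
      (dot v v *+ 2 + dot u u *+ 2 - 2 ^+ 2 * X) =
      (d + n.+1%:R^-1 - dot u u) *+ 2 + (d + m.+1%:R^-1 - dot v v) *+ 2 +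
      (X - d) *+ 4 by ring.
  by apply: addr_ge0; [apply: addr_ge0|]; apply: mulrn_wge0; rewrite subr_ge0.
apply/cvgrPdist_lt => e e0.
have [_ kw] := kP.1 _ wD.
(* The squared error at [w] is at most the squared norm of [k w] times [n.+1%:R^-1]; the added 1
   covers [k w = 0]. *)
have c0 : 0 < e ^+ 2 / (dot (k w) (k w) + 1).
  by rewrite divr_gt0 ?exprn_gt0// ltr_wpDl.
apply: filterS (near_natSinv_lt_complex c0) => n.
rewrite ltr_pdivlMr ?ltr_wpDl// => h.
rewrite -ahm_evalB// kw -(@ltr_pXn2r _ 2)// ?nnegrE ?(ltW e0)//.
apply: le_lt_trans h.
apply: (le_trans (@sqr_normr_dot_le _ _ _ d _ _ _)) => [c|].
  have -> : f - comb (l n) - c *: k w = f - comb ((c, w) :: l n).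
    by rewrite /comb big_cons/= opprD addrA addrAC.
  exact: dmin.
rewrite mulrC ler_pM ?subr_ge0 ?dmin//; last by rewrite lerDl.
by rewrite lerBlDl.
Qed.

End Combination.

(** * From equal kernels to unitary equivalence *)

(** The lists approximating [f] in [H1] are reused in [H2]: the Gram matrices agree, so the sequence
    is Cauchy there too, and values and norms pass to the limit. *)
Lemma same_kernel_transfer (R : realType) (H1 H2 : analyticHilbertModule R) K :
  has_reproducing_kernel H1 K -> has_reproducing_kernel H2 K ->
  forall f : H1, exists g : H2,
    (forall z, bidisc z -> ahm_eval g z = ahm_eval f z) /\
    ahm_dot H2 g g = ahm_dot H1 f f.
Proof.
move=> /kernel_sectionsP[k1 k1P] /kernel_sectionsP[k2 k2P] f.
have [l [l_cauchy l_ev]] := approx_comb k1P f.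
have combE l' z : bidisc z -> ahm_eval (comb k1 l') z = ahm_eval (comb k2 l') z.
  by move=> zD; rewrite (eval_comb k1P)// (eval_comb k2P).
have dotE l' : ahm_dot H2 (comb k2 l') (comb k2 l') =
    ahm_dot H1 (comb k1 l') (comb k1 l').
  rewrite (dot_comb k1P) (dot_comb k2P); apply: eq_bigr => p /asboolP pD.
  by rewrite combE.
have combB (H : analyticHilbertModule R) (k : _ -> H) l' l'' :
    comb k l' - comb k l'' = comb k (l' ++ [seq (-1 * p.1, p.2) | p <- l'']).
  by rewrite comb_cat comb_scale scaleN1r.
pose s n := comb k1 (l n); pose t n := comb k2 (l n).
have s_cvg : s @ \oo --> lim (s @ \oo) by exact: cvg_of_dot_le.
have t_cvg : t @ \oo --> lim (t @ \oo).
  by apply: cvg_of_dot_le => n m; rewrite /t combB dotE -combB.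
set g := lim (t @ \oo) in t_cvg.
have ev_unique z (a b : R[i]^o) :
    (fun n => ahm_eval (s n) z : R[i]^o) @ \oo --> a ->
    (fun n => ahm_eval (s n) z : R[i]^o) @ \oo --> b -> a = b.
  exact: cvg_unique.
(* Norm convergence implies pointwise convergence, and the pointwise limit is already known to be
   [f]. *)
have s_lim : lim (s @ \oo) = f.
  apply: ahm_eval_inj => z zD; apply: ev_unique _ (l_ev _ zD).
  by have [_ kz] := k1P.1 _ zD; exact: eval_cvg kz s_cvg.
rewrite s_lim in s_cvg.
exists g; split=> [z zD|].
  apply: ev_unique _ (l_ev _ zD).
  rewrite (_ : (fun n => _) = (fun n => ahm_eval (t n) z)); last first.
    by apply/funext => n; exact: combE.
  by have [_ kz] := k2P.1 _ zD; exact: eval_cvg kz t_cvg.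
rewrite !dot_sqr_norm; congr (_ ^+ 2).
have sn := cvg_norm s_cvg; have tn := cvg_norm t_cvg.
have E : (fun n => `|t n|) = (fun n => `|s n|).
  by apply/funext => n; rewrite !ahm_norm dotE.
rewrite E in tn; exact: cvg_unique (tn _) (sn _).
Qed.

Lemma same_kernel_unitarily_equivalent (R : realType)
    (H1 H2 : analyticHilbertModule R) K :
  has_reproducing_kernel H1 K -> has_reproducing_kernel H2 K ->
  unitarily_equivalent H1 H2.
Proof.
move=> H1K H2K.
have /choice[U UP] := same_kernel_transfer H1K H2K.
have U_ev f z : bidisc z -> ahm_eval (U f) z = ahm_eval f z by exact: (UP f).1.
have U_lin : linear U.
  move=> a f g; apply: ahm_eval_inj => z zD.
  by rewrite U_ev// !ahm_eval_linear// !U_ev.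
pose UM := GRing.isLinear.Build _ _ _ _ U U_lin.
pose UL : {linear H1 -> H2} := HB.pack U UM.
exists UL; split.
- by apply: isometry_dnorm => f; exact: (UP f).2.
- split=> //.
    move=> f g _ _ /= UfUg; apply: ahm_eval_inj => z zD.
    by rewrite -U_ev// UfUg U_ev.
  move=> g _; have [f [fg _]] := same_kernel_transfer H2K H1K g.
  by exists f => //; apply: ahm_eval_inj => z zD; rewrite U_ev// fg.
- move=> i f; apply: ahm_eval_inj => z zD.
  by rewrite U_ev// !ahm_mulE// U_ev.
Qed.

(** * From unitary equivalence to a relation between kernels *)

Lemma intertwiner_poly (R : realType) (H1 H2 : analyticHilbertModule R)
    (U : {linear H1 -> H2}) :
  (forall i f, U (ahm_mul i f) = ahm_mul i (U f)) ->
  exists phi : R[i] * R[i] -> R[i],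
    forall (p : {poly {poly R[i]}}) (f : H1),
      (forall z, bidisc z -> ahm_eval f z = p.[z.1, z.2]) ->
      forall z, bidisc z -> ahm_eval (U f) z = p.[z.1, z.2] * phi z.
Proof.
move=> UM; have [one oneE] := ahm_poly H1 1.
exists (ahm_eval (U one)).
pose good (q : R[i] * R[i] -> R[i]) := exists f : H1, forall z, bidisc z ->
  ahm_eval f z = q z /\ ahm_eval (U f) z = q z * ahm_eval (U one) z.
have goodC a : good (fun=> a).
  exists (a *: one) => z zD; rewrite linearZ !ahm_evalZ// oneE//.
  by rewrite !hornerE.
have goodMD i q q' : good q -> good q' ->
    good (fun z => q z * Defs.coord i z + q' z).
  move=> [f fP] [g gP]; exists (ahm_mul i f + g) => z zD.
  have [fz Ufz] := fP z zD; have [gz Ugz] := gP z zD.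
  rewrite linearD UM !ahm_evalD// !ahm_mulE// fz gz Ufz Ugz.
  by split; ring.
(* Horner induction, first on the outer variable, evaluated at [z.1], then on the inner one,
   evaluated at [z.2]. *)
have goodP (p : {poly {poly R[i]}}) : good (fun z => p.[z.1, z.2]).
  elim/poly_ind: p => [|p c IHp].
    by have := goodC 0; congr good; apply/funext => z; rewrite !horner0.
  have goodc : good (fun z => c.[z.2]).
    elim/poly_ind: c {p IHp} => [|c a IHc].
      by have := goodC 0; congr good; apply/funext => z; rewrite horner0.
    have := goodMD ord_max _ _ IHc (goodC a); congr good; apply/funext => z.
    by rewrite !hornerE.
  have := goodMD ord0 _ _ IHp goodc; congr good; apply/funext => z.
  by rewrite !hornerE.
move=> p f fp z zD; have [g gP] := goodP p.
have -> : f = g by apply: ahm_eval_inj => w wD; rewrite fp// (gP w wD).1.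
exact: (gP z zD).2.
Qed.

Lemma unitarily_equivalent_kernel (R : realType)
    (H1 H2 : analyticHilbertModule R) K1 K2 :
  has_reproducing_kernel H1 K1 -> has_reproducing_kernel H2 K2 ->
  unitarily_equivalent H1 H2 ->
  exists phi : R[i] * R[i] -> R[i], forall z w, bidisc z -> bidisc w ->
    K2 z w = phi z * (phi w)^*%C * K1 z w.
Proof.
move=> /kernel_sectionsP[k1 k1P] /kernel_sectionsP[k2 k2P] [U [Uiso Ubij UM]].
have {}Uiso u v : ahm_dot H2 (U u) (U v) = ahm_dot H1 u v by exact: Uiso.
have [phi phiP] := intertwiner_poly UM; exists phi.
(* Pull [k2 w] back to [h] along [U] and test against polynomials [p]: both sides pair to [p] times
   [phi] at [w]. *)
have k2E w : bidisc w -> k2 w = (phi w)^* *: U (k1 w).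
  move=> wD; have [_ _ /(_ (k2 w) I)[h _ hk]] := Ubij.
  rewrite -linearZ -hk; congr (U _); apply/subr0_eq.
  apply: (dense_dot_eq0 (@ahm_poly_dense R H1)) => f [p fp].
  rewrite linearBr linearZr_LR/= conjCK -Uiso [in X in X - _]hk.
  rewrite -(k1P.1 _ wD).2 -(k2P.1 _ wD).2 (phiP p)// fp//.
  by rewrite mulrC subrr.
move=> z w zD wD; rewrite -(k2P.1 _ wD).1// (k2P.1 _ zD).2 !k2E//.
rewrite linearZl_LR linearZr_LR/= conjCK Uiso -(k1P.1 _ zD).2.
by rewrite (k1P.1 _ wD).1//; ring.
Qed.

(** * Reading off the exponents at real points *)

Lemma principal_pow_real (R : realType) (r a : R) : 0 < r ->
  principal_pow r%:C%C a = (r `^ a)%:C%C.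
Proof.
move=> r0; rewrite /principal_pow /principal_arg /=.
rewrite expr0n/= addr0 sqrtr_sqr gtr0_norm// divff ?gt_eqF// lexx acos1.
by rewrite mulr0 cos0 sin0 mulr1.
Qed.

Lemma bidisc_real (R : realType) (x y : R) : `|x| < 1 -> `|y| < 1 ->
  bidisc (x%:C%C, y%:C%C).
Proof.
by move=> x1 y1; split; rewrite /= normc_def/= expr0n/= addr0 sqrtr_sqr ltcR.
Qed.

Lemma kernelB_real (R : realType) (a b c x1 x2 y1 y2 : R) :
  `|x1| < 1 -> `|x2| < 1 -> `|y1| < 1 -> `|y2| < 1 ->
  kernelB a b c (x1%:C%C, x2%:C%C) (y1%:C%C, y2%:C%C) =
  ((1 - x1 * y1) `^ (- a) * (1 - x2 * y2) `^ (- b) *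
   (1 - x1 * y2) `^ c * (1 - x2 * y1) `^ c)%:C%C.
Proof.
have pos (x y : R) : `|x| < 1 -> `|y| < 1 -> 0 < 1 - x * y.
  move=> x1' y1'; rewrite subr_gt0 (le_lt_trans (ler_norm _))// normrM.
  by rewrite -[ltRHS]mulr1 ltr_pM.
move=> hx1 hx2 hy1 hy2; rewrite /kernelB /fst /snd !conjc_real.
have E (x y : R) : 1 - x%:C%C * y%:C%C = (1 - x * y)%:C%C :> R[i].
  by rewrite rmorphB rmorphM rmorph1.
by rewrite !E !principal_pow_real ?pos// !rmorphM.
Qed.

Lemma powR_exponent_inj (R : realType) (r : R) : 0 < r -> r != 1 ->
  injective (@powR R r).
Proof.
move=> r0 r1 a b /(congr1 (@ln R)); rewrite !ln_powR => /mulIf; apply.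
by rewrite ln_eq0.
Qed.

Theorem theorem4p3 (R : realType)
    (alpha1 beta1 gamma1 alpha2 beta2 gamma2 : R)
    (gamma1_gt0 : 0 < gamma1)
    (alpha1_gt : gamma1 < alpha1) (beta1_gt : gamma1 < beta1)
    (gamma2_gt0 : 0 < gamma2)
    (alpha2_gt : gamma2 < alpha2) (beta2_gt : gamma2 < beta2)
    (H1 H2 : analyticHilbertModule R)
    (H1_kernel : has_reproducing_kernel H1 (kernelB alpha1 beta1 gamma1))
    (H2_kernel : has_reproducing_kernel H2 (kernelB alpha2 beta2 gamma2)) :
  unitarily_equivalent H1 H2 <->
  alpha1 = alpha2 /\ beta1 = beta2 /\ gamma1 = gamma2.
Proof.
split=> [/(unitarily_equivalent_kernel H1_kernel H2_kernel)[phi phiK]|];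
  last first.
  move=> [aE [bE cE]]; move: H1_kernel; rewrite aE bE cE => H1_kernel'.
  exact: same_kernel_unitarily_equivalent H1_kernel' H2_kernel.
have n0 : `|0 : R| < 1 by rewrite normr0.
have h0 : `|2^-1 : R| < 1.
  by rewrite ger0_norm ?invr_ge0// invf_lt1// ltr1n.
pose O : R[i] * R[i] := ((0 : R)%:C%C, (0 : R)%:C%C).
have OD : bidisc O by exact: bidisc_real.
have KO a b c (x y : R) : `|x| < 1 -> `|y| < 1 ->
    kernelB a b c (x%:C%C, y%:C%C) O = 1.
  by move=> x1 y1; rewrite kernelB_real// !mulr0 subr0 !powR1 !mulr1.
have phi1 (x y : R) : `|x| < 1 -> `|y| < 1 ->
    phi (x%:C%C, y%:C%C) * (phi O)^*%C = 1.
  move=> x1 y1; have := phiK _ _ (bidisc_real x1 y1) OD.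
  by rewrite !KO// mulr1 => ->.
have phiO0 : (phi O)^*%C != 0.
  apply/eqP => e; have := phi1 _ _ n0 n0.
  by rewrite e mulr0 => /esym/eqP; rewrite oner_eq0.
(* Only real points are needed below; there [phi] is constant, with squared modulus 1. *)
have phiE (x y : R) : `|x| < 1 -> `|y| < 1 -> phi (x%:C%C, y%:C%C) = phi O.
  by move=> x1 y1; apply: (mulIf phiO0); rewrite phi1// phi1.
have KE (x1 x2 y1 y2 : R) : `|x1| < 1 -> `|x2| < 1 -> `|y1| < 1 -> `|y2| < 1 ->
    kernelB alpha2 beta2 gamma2 (x1%:C%C, x2%:C%C) (y1%:C%C, y2%:C%C) =
    kernelB alpha1 beta1 gamma1 (x1%:C%C, x2%:C%C) (y1%:C%C, y2%:C%C).
  move=> *; rewrite phiK; [|exact: bidisc_real..].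
  by rewrite !phiE// phi1// mul1r.
pose r : R := 1 - 2^-1 * 2^-1.
have r0 : 0 < r by rewrite subr_gt0 -invfM invf_lt1// -natrM ltr1n.
have r1 : r != 1.
  by rewrite /r -subr_eq0 addrAC subrr add0r oppr_eq0 mulf_neq0// invr_eq0.
have inj := powR_exponent_inj r0 r1.
(* With coordinates 0 and 1/2, exactly one factor of the kernel has base [r] and the others are 1:
   the points [z = w = (1/2, 0)] isolate alpha, [z = w = (0, 1/2)] beta, and [z = (1/2, 0)],
   [w = (0, 1/2)] gamma. *)
split; [|split].
- have := KE _ _ _ _ h0 n0 h0 n0.
  rewrite !kernelB_real// !(mulr0, mul0r, subr0, powR1, mulr1).
  by move=> /complexI /inj /oppr_inj.
- have := KE _ _ _ _ n0 h0 n0 h0.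
  rewrite !kernelB_real// !(mulr0, mul0r, subr0, powR1, mulr1, mul1r).
  by move=> /complexI /inj /oppr_inj.
- have := KE _ _ _ _ h0 n0 n0 h0.
  rewrite !kernelB_real// !(mulr0, mul0r, subr0, powR1, mulr1, mul1r).
  by move=> /complexI /inj.
Qed.
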